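(* Let $\mathbf p=(p_1,\dots,p_n)$ be a probability vector, let $G$ be a compact abelian metrizable group with Haar probability measure $\nu$ and a translation-invariant metric, and let $g_1,\dots,g_n\in G$. Let $B=\{1,\dots,n\}^{\mathbf N^*}$ with product measure $\mu$ giving symbol $j$ weight $p_j$, let $\sigma$ be the shift on $B$, let $\lambda=\mu\times\nu$, and define $S:B\times G\to B\times G$ by $S(x,g)=(\sigma x,\,g\,g_j)$ if $x_0=j$. Then the $\mathbf p$-endomorphism $(B\times G,\lambda,S)$ is tvwB if there exist $i\ne j$ with $p_i=p_j$ such that $g_jg_i^{-1}$ has dense orbit in $G$ (i.e. $\{(g_jg_i^{-1})^k: k\ge 0\}$ is dense in $G$).
   Context: **Conventions.** $\mathbf N^*=\{0,1,2,\dots\}$; $(\sigma x)_j=x_{j+1}$. All components of $\mathbf p$ are positive. **Measure-preserving systems.** A measure-preserving system (m.p.s.) is a quadruple $(X,\mathcal B,\mu,T)$ where $X$ is a compact metric space with Borel $\sigma$-algebra $\mathcal B$, $(X,\mathcal B,\mu)$ is a nonatomic Lebesgue probability space (isomorphic to $[0,1]$ with Lebesgue measure), and $T:X\to X$ is measurable with $\mu(T^{-1}B)=\mu(B)$ for $B\in\mathcal B$. **$\mathbf p$-endomorphisms.** For $\mathbf p=(p_1,\dots,p_n)$ let $h(\mathbf p)=-\sum_j p_j\log_2 p_j$. An m.p.s. $(X,\mathcal B,\mu,T)$ is a $\mathbf p$-endomorphism if $T$ is $n$-to-1 a.e., for a.a. $x$ the conditional probabilities (given $x$) of the $n$ preimages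 of $x$ under $T$ are the components of $\mathbf p$ (with multiplicity), and its entropy is $h(\mathbf p)$. **Trees.** $\mathcal T$ is the set of all finite sequences (nodes) of elements of $\{1,\dots,n\}$, including the empty one; $|v|$ is the length of $v$; $\mathcal T'$ is the set of nonempty nodes; $\mathcal T_N=\{v:|v|\le N\}$, $\mathcal T_N'=\{v:0<|v|\le N\}$. $\varsigma:\mathcal T'\to\mathcal T$ deletes the leftmost symbol. The weight of $v=(a_1,\dots,a_j)$ is $w_v=\prod_i p_{a_i}$ (and $1$ for the empty node). A tree automorphism is a bijection $A:\mathcal T\to\mathcal T$ with $A\varsigma(v)=\varsigma A(v)$ and $w_{Av}=w_v$ for all $v\in\mathcal T'$; $\mathcal A_N$ is the set of restrictions of tree automorphisms to $\mathcal T_N$. For a compact metric space $(R,d)$ and functions $h,h'$ into $R$ defined on $\mathcal T_N'$ (or on $\mathcal T'$), $$\bar t_N(h,h')=\frac1N\inf_{A\in\mathcal A_N}\sum_{0<|v|\le N}w_v\,d(h(v),h'(Av)).$$ **Tree names.** A tree partition of a $\mathbf p$-endomorphism $(X,\mathcal B,\mu,T)$ is a measurable $K:X\to\{1,\dots,n\}$ such that for a.a. $x$ the $n$ preimages of $x$ have distinct $K$-values and the preimage with $K$-value $j$ has conditional probability $p_j$. Fix one. For $j\in\{1,\dots,n\}$, $T_jx$ is the preimage of $x$ with $K$-value $j$; for $v=(a_1,\dots,a_m)$, $T_vx=T_{a_1}(T_{a_2}\cdots(T_{a_m}x)\cdots)$. For $g:X\to R$ the $g$-tree name of $x$ is $\tau_x^g:\mathcal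 T'\to R$, $\tau_x^g(v)=g(T_vx)$. **tvwB.** For a $\mathbf p$-endomorphism $\mathbf X$ and a measurable $g:X\to R$ into a compact metric space, $(\mathbf X,g)$ is tvwB (tree very weak Bernoulli) if for every $\varepsilon>0$ there is $N$ such that for every $m\ge N$ there is a set $H\subseteq X$ of measure at least $1-\varepsilon$ with $\bar t_m(\tau_x^g,\tau_y^g)<\varepsilon$ for all $x,y\in H$ (independent of the choice of $K$). $\mathbf X$ is tvwB if $(\mathbf X,g)$ is tvwB for every compact metric space $R$ and every measurable $g:X\to R$. *)

(* Defs.v *)
From HB Require Import structures.
From mathcomp Require Import all_boot all_order all_algebra.
From mathcomp Require Import all_classical all_reals all_analysis.

Set Implicit Arguments.
Unset Strict Implicit.
Unset Printing Implicit Defensive.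

Import Order.TTheory GRing.Theory Num.Theory.
Import numFieldNormedType.Exports.

Local Open Scope classical_set_scope.
Local Open Scope ring_scope.

(* A node (a_1, ..., a_m) is the sequence [:: a_1; ...; a_m]; symbols are
   numbered from 0. *)
Definition node (n : nat) := seq 'I_n.

Section trees.
Context {R : realType} {n : nat}.
Variable p : 'I_n -> R.

Definition weight (v : node n) : R := \prod_(a <- v) p a.

(* Since [behead] is total, the case [A v = [::]] is not excluded by typing; it
   is by bijectivity: [A v = [::]] with [v != [::]] would give
   [A (behead v) = A v].  Hence [A] fixes the root and preserves [size]. *)
Definition tree_automorphism (A : node n -> node n) : Prop :=
  bijective A /\
  forall v, v != [::] ->
    A (behead v) = behead (A v) /\ weight (A v) = weight v.

(* The sum only involves the restriction of [A] to the nodes of length at most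
   [N], so the infimum is over restrictions of automorphisms.  The values of
   [h] and [h'] at the root are never used. *)
Definition tbar {Y : metricType R} (N : nat) (h h' : node n -> Y) : R :=
  N%:R^-1 *
  inf [set s : R | exists A : node n -> node n, tree_automorphism A /\
    s = \sum_(1 <= k < N.+1) \sum_(v : k.-tuple 'I_n)
          weight v * mdist (h v) (h' (A v))].

End trees.

Section endomorphisms.
Context {R : realType} {d : measure_display} {X : measurableType d} {n : nat}.
Variables (p : 'I_n -> R) (mu : {measure set X -> \bar R}) (T : X -> X).

Definition measure_preserving : Prop :=
  measurable_fun [set: X] T /\
  forall A, measurable A -> mu (T @^-1` A) = mu A.

(* [kappa x] is the conditional distribution, under [mu], of a point [y] given
   [T y = x]. *)
Definition preimage_law (kappa : R.-pker X ~> X) : Prop :=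
  forall A C, measurable A -> measurable C ->
    mu (A `&` T @^-1` C) = (\int[mu]_(x in C) kappa x A)%E.

(* The conditional probabilities of the [n] preimages of a.e. point are the
   components of [p], counted with multiplicity: [e] enumerates the fibre. *)
Definition n_to_one : Prop :=
  exists2 kappa : R.-pker X ~> X, preimage_law kappa &
  {ae mu, forall x, exists2 e : X -> 'I_n,
    set_bij (T @^-1` [set x]) [set: 'I_n] e &
    forall y, T y = x -> kappa x [set y] = (p (e y))%:E}.

Definition tree_partition (K : X -> 'I_n) : Prop :=
  (forall j, measurable (K @^-1` [set j])) /\
  exists2 kappa : R.-pker X ~> X, preimage_law kappa &
  {ae mu, forall x,
    set_bij (T @^-1` [set x]) [set: 'I_n] K /\
    forall y, T y = x -> kappa x [set y] = (p (K y))%:E}.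

(* The preimage of [x] with [K]-value [j]; a default value on the null set of
   those [x] that have none. *)
Definition branch (K : X -> 'I_n) (j : 'I_n) (x : X) : X :=
  get [set y | T y = x /\ K y = j].

Definition branches (K : X -> 'I_n) (v : node n) (x : X) : X :=
  foldr (branch K) x v.

Definition tree_name (K : X -> 'I_n) {Y : Type} (g : X -> Y) (x : X) :
    node n -> Y :=
  fun v => g (branches K v x).

Definition borel_measurable {Y : topologicalType} (g : X -> Y) : Prop :=
  forall A, <<s @open Y >> A -> measurable (g @^-1` A).

Definition tvwB_fun (K : X -> 'I_n) {Y : metricType R} (g : X -> Y) : Prop :=
  forall eps : R, 0 < eps ->
  exists N : nat, forall m : nat, (N <= m)%N ->
  exists H : set X,
    [/\ measurable H,
        ((1 - eps)%:E <= mu H)%E &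
        forall x y, H x -> H y ->
          tbar p m (tree_name K g x) (tree_name K g y) < eps].

(* The notion does not depend on the tree partition; the first conjunct keeps
   the quantification over all of them from being vacuous. *)
Definition tvwB : Prop :=
  (exists K, tree_partition K) /\
  forall K, tree_partition K ->
  forall Y : metricType R, compact [set: Y] ->
  forall g : X -> Y, borel_measurable g -> tvwB_fun K g.

End endomorphisms.

Definition invariant_metric {R : realType} {G : topologicalZmodType}
    (dist : G -> G -> R) : Prop :=
  [/\ forall x y, 0 <= dist x y,
      forall x y, dist x y = 0 <-> x = y,
      forall x y, dist x y = dist y x &
      forall x y z, dist x z <= dist x y + dist y z] /\
  [/\ forall (x : G) (U : set G), nbhs x U <->
        exists2 e : R, 0 < e & [set y | dist x y < e] `<=` U &
      forall a x y, dist (a + x) (a + y) = dist x y].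

(* The library only builds a measurableType on a pointed type, whence this copy
   of [G] with distinguished point 0. *)
Definition pointed_copy (G : topologicalZmodType) : Type := G.

HB.instance Definition _ (G : topologicalZmodType) :=
  Choice.on (pointed_copy G).
HB.instance Definition _ (G : topologicalZmodType) :=
  isPointed.Build (pointed_copy G) (0 : G).

Definition borel (G : topologicalZmodType) :=
  g_sigma_algebraType (@open G : set (set (pointed_copy G))).

Definition is_haar {R : realType} {G : topologicalZmodType}
    (nu : probability (borel G) R) : Prop :=
  forall (a : G) (A : set G), <<s @open G >> A ->
    nu ((fun x : G => a + x) @^-1` A) = nu A.

HB.instance Definition _ (n : nat) := isPointed.Build 'I_n.+1 ord0.

Definition coordinate_sets (n : nat) : set (set (nat -> 'I_n.+1)) :=
  [set C | exists k j, C = [set x | x k = j]].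

(* The space of one-sided sequences with the product sigma-algebra. *)
Definition words (n : nat) := g_sigma_algebraType (@coordinate_sets n).

Definition is_bernoulli {R : realType} {n : nat} (p : 'I_n.+1 -> R)
    (mu : probability (words n) R) : Prop :=
  forall v : node n.+1,
    mu [set x | forall k, (k < size v)%N -> x k = nth ord0 v k] =
    (weight p v)%:E.

Definition shift {A : Type} (x : nat -> A) : nat -> A := fun k => x k.+1.

Definition skew_shift {n : nat} {G : topologicalZmodType} (g : 'I_n.+1 -> G)
    (z : words n * borel G) : words n * borel G :=
  (shift z.1, (z.2 : G) + g (z.1 0%N)).

(* Main.v *)
(* Two points (x, h) and (y, h') of B * G have the tree names
   v |-> f (v x, h - g_v) and v |-> f (v y, h' - g_v), where g_v is the sum of
   the g_a over the symbols a of v.  Match the two trees level by level with a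
   tree automorphism that exchanges the symbols i and j, which have the same
   weight, as long as the difference of the two G-coordinates is not close to 0,
   and copies the symbols afterwards.  While symbols are exchanged, a run of k
   symbols i adds k (g_j - g_i) to the difference; since the orbit of g_j - g_i
   is dense and G is compact, some m bounds the length of the run needed to come
   close to 0 from any starting point, so the weight of the unmatched nodes
   decays geometrically.  Past the matching, the metric being invariant, the
   differences stay small, and the two words agree on longer and longer prefixes.
   A measurable f is almost continuous along such pairs outside a set E of small
   measure, and by Markov's inequality the tree of most points visits E rarely.
   An arbitrary tree partition differs from the one given by the first symbol by
   weight-preserving permutations of the branches at almost every node. *)
Require Import Defs.
From HB Require Import structures.
From mathcomp Require Import all_boot all_order all_algebra all_fingroup.
From mathcomp Require Import all_classical all_reals all_analysis.
From mathcomp Require Import measurable_realfun zify ring lra.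

Set Implicit Arguments.
Unset Strict Implicit.
Unset Printing Implicit Defensive.

Import Order.TTheory GRing.Theory Num.Theory.
Import numFieldNormedType.Exports.

Local Open Scope classical_set_scope.
Local Open Scope ring_scope.

(** * Averages over the levels of a weighted tree *)

Section level_sums.
Context {R : realType} {n : nat}.
Variable p : 'I_n -> R.

(** When [p] is a probability vector, this is the expectation of [F] at a random node of length [k]
    with independent symbols of law [p]. *)
Definition level_sum (k : nat) (F : node n -> R) : R :=
  \sum_(v : k.-tuple 'I_n) weight p v * F v.

Lemma level_sum0 F : level_sum 0 F = F [::].
Proof.
rewrite /level_sum (bigD1 [tuple])//= big1 ?addr0.
  by rewrite /weight big_nil mul1r.
by move=> v /eqP[]; rewrite tuple0.
Qed.

Lemma level_sumS k F :
  level_sum k.+1 F = \sum_a p a * level_sum k (fun v => F (a :: v)).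
Proof.
under eq_bigr do rewrite /level_sum big_distrr/=.
rewrite pair_big/= /level_sum.
rewrite (reindex (fun av : 'I_n * k.-tuple 'I_n => [tuple of av.1 :: av.2]))/=.
  by apply: eq_bigr => -[a v] _ /=; rewrite /weight big_cons mulrA.
exists (fun v : k.+1.-tuple 'I_n => (thead v, [tuple of behead v])) => [[a v] _|v _].
  by congr (_, _); exact/val_inj.
by rewrite /= -tuple_eta.
Qed.

Lemma eq_level_sum k F F' : F =1 F' -> level_sum k F = level_sum k F'.
Proof. by move=> FF'; apply: eq_bigr => v _; rewrite FF'. Qed.

Lemma level_sumZ k c F : level_sum k (fun v => c * F v) = c * level_sum k F.
Proof. by rewrite /level_sum big_distrr; apply: eq_bigr => v _; rewrite mulrCA. Qed.

Lemma level_sumD k F F' :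
  level_sum k (fun v => F v + F' v) = level_sum k F + level_sum k F'.
Proof. by rewrite -big_split; apply: eq_bigr => v _; rewrite mulrDr. Qed.

(** Weights are multiplicative. As the parent map deletes the leftmost symbol, [w] is an ancestor of
    [v ++ w], and the identity conditions on the ancestor at level [l]. *)
Lemma level_sum_cat k l F :
  level_sum (k + l) F = level_sum l (fun w => level_sum k (fun v => F (v ++ w))).
Proof.
elim: k F => [|k IH] F.
  by apply: eq_level_sum => v; rewrite level_sum0.
rewrite addSn level_sumS.
transitivity (level_sum l (fun w =>
    \sum_a p a * level_sum k (fun v => F (a :: v ++ w)))); last first.
  by apply: eq_level_sum => w; rewrite level_sumS.
under eq_bigr do rewrite IH /level_sum big_distrr/=.
rewrite exchange_big; apply: eq_bigr => w _; rewrite big_distrr/=.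
by apply: eq_bigr => a _; rewrite mulrCA.
Qed.

Hypothesis p_ge0 : forall a, 0 <= p a.

Lemma weight_ge0 v : 0 <= weight p v.
Proof. by apply: prodr_ge0 => a _; exact: p_ge0. Qed.

Lemma le_level_sum k F F' :
  (forall v, size v = k -> F v <= F' v) -> level_sum k F <= level_sum k F'.
Proof.
move=> FF'; apply: ler_sum => v _; apply: ler_wpM2l; first exact: weight_ge0.
by apply: FF'; rewrite size_tuple.
Qed.

Lemma level_sum_ge0 k F : (forall v, 0 <= F v) -> 0 <= level_sum k F.
Proof. by move=> F0; apply: sumr_ge0 => v _; rewrite mulr_ge0 ?weight_ge0. Qed.

Hypothesis p_sum1 : \sum_a p a = 1.

Lemma level_sum_cst k c : level_sum k (fun=> c) = c.
Proof.
elim: k => [|k IH]; first by rewrite level_sum0.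
by rewrite level_sumS IH -big_distrl/= p_sum1 mul1r.
Qed.

End level_sums.

(** * Tree automorphisms built from permutations of children *)

Section twists.
Context {R : realType} {n : nat}.
Variable p : 'I_n -> R.

(** The children of [w] are the nodes [a :: w]; [s w] permutes them, the index [w] being the node
    before the twist. *)
Fixpoint twist (s : node n -> {perm 'I_n}) (v : node n) : node n :=
  if v is a :: w then s w a :: twist s w else [::].

Fixpoint untwist (s : node n -> {perm 'I_n}) (v : node n) : node n :=
  if v is a :: w then let u := untwist s w in (s u)^-1%g a :: u else [::].

Lemma twistK s : cancel (twist s) (untwist s).
Proof. by elim=> //= a v ->; rewrite permK. Qed.

Lemma untwistK s : cancel (untwist s) (twist s).
Proof. by elim=> //= a v ->; rewrite permKV. Qed.

Lemma twist_comp s t v :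
  twist t (twist s v) = twist (fun w => (s w * t (twist s w))%g) v.
Proof. by elim: v => //= a v ->; rewrite permM. Qed.

Variable s : node n -> {perm 'I_n}.
Hypothesis s_p : forall v a, p (s v a) = p a.

Lemma weight_twist v : weight p (twist s v) = weight p v.
Proof. by elim: v => //= a v IH; rewrite /weight !big_cons -!/(weight _ _) IH s_p. Qed.

Lemma twist_automorphism : tree_automorphism p (twist s).
Proof.
split; first by exists (untwist s); [exact: twistK|exact: untwistK].
by move=> [//|a v] _ /=; split=> //; exact: (weight_twist (a :: v)).
Qed.

Lemma level_sum_twist k F :
  level_sum p k (fun v => F (twist s v)) = level_sum p k F.
Proof.
elim: k F => [|k IH] F; first by rewrite !level_sum0.
rewrite !level_sumS.
(* [F'] averages [F] over the children of a node. The induction hypothesis twists the parent, and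
   reindexing by [s w] then twists the child. *)
pose F' w := \sum_a p a * F (a :: w).
transitivity (level_sum p k F'); last first.
  rewrite /F' /level_sum; under [RHS]eq_bigr do rewrite big_distrr/=.
  rewrite exchange_big; apply: eq_bigr => w _; rewrite big_distrr/=.
  by apply: eq_bigr => a _; rewrite mulrCA.
rewrite -IH /F' /level_sum; under [LHS]eq_bigr do rewrite big_distrr/=.
rewrite exchange_big; apply: eq_bigr => w _; rewrite big_distrr/=.
rewrite [RHS](reindex_inj (@perm_inj _ (s w)))/=.
by apply: eq_bigr => a _; rewrite s_p mulrCA.
Qed.

End twists.

Section tree_automorphisms.
Context {R : realType} {n : nat}.
Variable p : 'I_n -> R.

Lemma tree_automorphism_comp A B : tree_automorphism p A ->
  tree_automorphism p B -> tree_automorphism p (A \o B).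
Proof.
move=> [[A' AK A'K] Ap] [Bbij Bp]; split; first by apply: bij_comp => //; exists A'.
move=> v v0 /=; have [Bv wBv] := Bp _ v0.
(* Otherwise [B (behead v)] and [B v] are both the root, and injectivity gives [behead v = v]. *)
have Bv0 : B v != [::].
  apply/eqP => Bv_nil; move: Bv; rewrite Bv_nil/= -Bv_nil => /(bij_inj Bbij).
  by move/(congr1 size); case: v v0 {wBv Bv_nil} => //= a v _ /n_Sn.
by have [ABv wABv] := Ap _ Bv0; rewrite Bv ABv wABv wBv.
Qed.

Lemma untwist_automorphism (s : node n -> {perm 'I_n}) :
  (forall v a, p (s v a) = p a) -> tree_automorphism p (untwist s).
Proof.
move=> s_p; split; first by exists (twist s); [exact: untwistK|exact: twistK].
move=> [//|a v] _; split => //.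
by rewrite -[in RHS](untwistK s (a :: v)) weight_twist.
Qed.

(** The automorphism [twist s' \o untwist s] matches [twist s v] with [twist s' v], and [twist s]
    preserves sums over levels. Two twists are allowed because the two trees will be relabelled
    independently. *)
Lemma tbar_le_twist {Y : metricType R} m (h h' : node n -> Y)
    (s s' : node n -> {perm 'I_n}) : (forall a, 0 <= p a) ->
    (forall v a, p (s v a) = p a) -> (forall v a, p (s' v a) = p a) ->
  tbar p m h h' <= m%:R^-1 *
    \sum_(1 <= k < m.+1)
      level_sum p k (fun v => mdist (h (twist s v)) (h' (twist s' v))).
Proof.
move=> p0 s_p s'_p; rewrite /tbar ler_wpM2l ?invr_ge0 ?ler0n//; apply: ge_inf.
  exists 0 => _ [A [_ ->]]; apply: sumr_ge0 => k _; apply: sumr_ge0 => v _.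
  by rewrite mulr_ge0 ?weight_ge0 ?mdist_ge0.
exists (twist s' \o untwist s); split.
  exact: tree_automorphism_comp (twist_automorphism s'_p) (untwist_automorphism s_p).
pose cost v := mdist (h v) (h' (twist s' (untwist s v))).
apply: eq_bigr => k _; rewrite -[RHS]/(level_sum p k cost) -[RHS](level_sum_twist s_p).
by apply: eq_level_sum => v; rewrite /cost twistK.
Qed.

End tree_automorphisms.

(** * Coupling two random walks by exchanging two symbols *)

Section coupling.
Context {R : realType} {G : zmodType} {n : nat}.
Variables (p : 'I_n -> R) (g : 'I_n -> G) (i j : 'I_n) (near : pred G).

Definition displacement (v : node n) : G := \sum_(a <- v) g a.

(* The leftmost symbol of a node is the last one applied, so both recursions
   decide about it from the rest of the node.  By [gapE], [gap d v] is the
   difference of the group coordinates of the nodes matched at [v] when that of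
   the roots is [d]. *)
Fixpoint gap (d : G) (v : node n) : G :=
  if v is a :: w then
    let e := gap d w in if near e then e else e - g a + g (tperm i j a)
  else d.

Definition coupling (d : G) (w : node n) : {perm 'I_n} :=
  if near (gap d w) then 1%g else tperm i j.

Lemma gapE d v :
  gap d v = d - displacement v + displacement (twist (coupling d) v).
Proof.
elim: v => [|a v IH] /=; first by rewrite /displacement big_nil subr0 addr0.
rewrite /displacement !big_cons -!/(displacement _) /coupling.
have E b : d - (g a + displacement v) +
    (g b + displacement (twist (coupling d) v)) = gap d v - g a + g b.
  by rewrite IH opprD !addrA [LHS](AC 5 (1*3*5*2*4)).
by case: ifP => _; rewrite E ?perm1 ?subrK.
Qed.

Lemma gap_cat d v w : gap d (v ++ w) = gap (gap d w) v.
Proof. by elim: v => //= a v ->. Qed.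

(** Being near is absorbing: symbols are copied from then on, which freezes the gap. *)
Lemma gap_near d v : near d -> gap d v = d.
Proof. by move=> nd; elim: v => //= a v ->; rewrite nd. Qed.

Lemma twist_coupling_cat d v w : near (gap d w) ->
  twist (coupling d) (v ++ w) = v ++ twist (coupling d) w.
Proof.
move=> nw; elim: v => //= a v ->; congr (_ :: _).
by rewrite /coupling gap_cat gap_near// nw perm1.
Qed.

Lemma gap_nseq d k : (forall l, (l < k)%N -> ~~ near (d + (g j - g i) *+ l)) ->
  gap d (nseq k i) = d + (g j - g i) *+ k.
Proof.
elim: k => [|k IH] far /=; first by rewrite mulr0n addr0.
rewrite IH => [|l lk]; last by apply: far; exact: ltnW.
rewrite (negbTE (far k _))// tpermL mulrSr -!addrA; congr (_ + (_ + _)).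
by rewrite addrC.
Qed.

Lemma near_gap_nseq d k m : (k <= m)%N -> near (d + (g j - g i) *+ k) ->
  near (gap d (nseq m i)).
Proof.
move=> km nk; have ex : exists k, near (d + (g j - g i) *+ k) by exists k.
(* The least [l] is the time of first arrival: before it every [i] is exchanged, after it the gap is
   frozen. *)
case: (ex_minnP ex) => l nl lmin.
have lm : (l <= m)%N by apply: leq_trans km; exact: lmin.
rewrite -(subnK lm) nseqD gap_cat [gap d _]gap_nseq ?gap_near// => l' l'l.
by apply/negP => /lmin; rewrite leqNgt l'l.
Qed.

Hypothesis pij : p i = p j.

Lemma coupling_weight d w a : p (coupling d w a) = p a.
Proof.
rewrite /coupling; case: ifP => _; first by rewrite perm1.
by case: tpermP => // ->.
Qed.

Hypothesis p_gt0 : forall a, 0 < p a.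
Hypothesis p_sum1 : \sum_a p a = 1.

Let p_ge0 a : 0 <= p a. Proof. exact: ltW. Qed.

(** The probability that the two walks, started at difference [d], are still unmatched after [k]
    steps. *)
Definition miss (k : nat) (d : G) : R :=
  level_sum p k (fun v => (~~ near (gap d v))%:R).

Lemma miss_cat k l d :
  miss (k + l) d = level_sum p l (fun w => miss k (gap d w)).
Proof.
rewrite /miss level_sum_cat; apply: eq_level_sum => w.
by apply: eq_level_sum => v; rewrite gap_cat.
Qed.

Lemma miss_near k d : near d -> miss k d = 0.
Proof.
by move=> nd; rewrite -[RHS](level_sum_cst p_sum1 k); apply: eq_level_sum => v;
  rewrite gap_near// nd.
Qed.

Lemma miss_le1 k d : miss k d <= 1.
Proof.
rewrite -[leRHS](level_sum_cst p_sum1 k); apply: le_level_sum => // v _.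
by case: near.
Qed.

(** Markov property: only walks unmatched after [l] steps contribute, and each of them misses the
    next [k] steps with probability at most [c]. *)
Lemma miss_cat_le c k l d : (forall e, miss k e <= c) -> miss (k + l) d <= c * miss l d.
Proof.
move=> mc; rewrite miss_cat -level_sumZ; apply: le_level_sum => // w _.
by case: (boolP (near _)) => nw; [rewrite miss_near// mulr0|rewrite mulr1].
Qed.

Variable m : nat.
Hypothesis reach : forall d, exists2 k, (k <= m)%N & near (d + (g j - g i) *+ k).

(** Whatever [d] is, the node made of [m] symbols [i] is matched, and its weight is [p i ^+ m]. *)
Lemma miss_period d : miss m d <= 1 - p i ^+ m.
Proof.
have [k km nk] := reach d; rewrite lerBrDl.
have -> : p i ^+ m = weight p (nseq_tuple m i).
  by rewrite /weight /= big_nseq -Monoid.iteropE.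
rewrite -[leRHS](level_sum_cst p_sum1 m) /miss /level_sum.
rewrite (bigD1 (nseq_tuple m i))//= [leRHS](bigD1 (nseq_tuple m i))//= mulr1.
rewrite (near_gap_nseq km nk)/= mulr0 add0r lerD2l.
apply: ler_sum => v _; apply: ler_wpM2l; first exact: weight_ge0.
by case: near.
Qed.

(** Each block of [m] steps multiplies the probability of a miss by at most [1 - p i ^+ m], which is
    below 1; the steps after the last full block do not increase it. *)
Lemma miss_small eta : 0 < eta ->
  exists l, forall k d, (l <= k)%N -> miss k d <= eta.
Proof.
move=> eta0; pose c := 1 - p i ^+ m.
have c0 : 0 <= c.
  apply: le_trans (miss_period 0); exact: level_sum_ge0.
have c1 : c < 1 by rewrite ltrBlDr ltrDl exprn_gt0.
have miss_pow l d : miss (l * m) d <= c ^+ l.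
  elim: l => [|l IH]; first by rewrite mul0n expr0 miss_le1.
  rewrite mulSn exprS; apply: le_trans (miss_cat_le _ _ miss_period) _.
  exact: ler_wpM2l.
have /cvgrPdist_lt/(_ _ eta0)[l _ cl] : c ^+ k @[k --> \oo] --> 0.
  by apply: cvg_expr; rewrite ger0_norm.
exists (l * m)%N => k d lk; rewrite -(subnK lk).
apply: le_trans (miss_cat_le _ _ (miss_le1 _)) _; rewrite mul1r.
apply: le_trans (miss_pow _ _) _.
by have := cl l (leqnn l); rewrite /= sub0r normrN ger0_norm ?exprn_ge0// => /ltW.
Qed.

End coupling.

(** * Endomorphisms with labelled inverse branches *)

Section mixtures.
Local Open Scope ereal_scope.
Context d (T : measurableType d) {R : realType} {n : nat} (p : 'I_n.+1 -> R).
Hypothesis p_ge0 : forall a, (0 <= p a)%R.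

(** [msum] sums a sequence indexed by naturals, whence [inord]. *)
Definition mixture (m : 'I_n.+1 -> {measure set T -> \bar R}) :
    {measure set T -> \bar R} :=
  msum (fun k => mscale (NngNum (p_ge0 (inord k))) (m (inord k))) n.+1.

Lemma mixtureE m A : mixture m A = \sum_a (p a)%:E * m a A.
Proof.
by rewrite /mixture /= /msum; apply: eq_bigr => a _; rewrite /mscale /= inord_val.
Qed.

Context d' (X : measurableType d') (f : 'I_n.+1 -> X -> T).
Hypothesis mf : forall a, measurable_fun [set: X] (f a).
Hypothesis p_sum1 : (\sum_a p a = 1)%R.

(** The candidate for the law of a point given its image [x]: mass [p a] at the preimage [f a x]. *)
Definition branch_kernel (x : X) : {measure set T -> \bar R} :=
  mixture (fun a => \d_(f a x)).

Lemma branch_kernelE x A :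
  branch_kernel x A = \sum_a (p a)%:E * (\1_(f a @^-1` A) x)%:E.
Proof. by rewrite /branch_kernel mixtureE. Qed.

Let measurable_branch_kernel A : measurable A ->
  measurable_fun [set: X] (branch_kernel ^~ A).
Proof.
move=> mA; under eq_fun do rewrite branch_kernelE.
apply: emeasurable_sum => a; apply: measurable_funeM.
apply/measurable_EFinP; apply: measurable_indic.
by rewrite -[_ @^-1` _]setTI; exact: mf.
Qed.

HB.instance Definition _ :=
  isKernel.Build _ _ X T R branch_kernel measurable_branch_kernel.

Let branch_kernel_prob x : branch_kernel x [set: T] = 1.
Proof.
rewrite branch_kernelE (eq_bigr (fun a => (p a)%:E)) => [|a _].
  by rewrite sumEFin p_sum1.
by rewrite preimage_setT indicT mule1.
Qed.

HB.instance Definition _ :=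
  Kernel_isProbability.Build _ _ X T R branch_kernel branch_kernel_prob.

Definition branch_pkernel : R.-pker X ~> T := branch_kernel.

End mixtures.

Section pushforward_mixtures.
Local Open Scope ereal_scope.
Context d (T : measurableType d) {R : realType} {n : nat} (p : 'I_n.+1 -> R).
Hypothesis p_ge0 : forall a, (0 <= p a)%R.
Variables (m : {measure set T -> \bar R}) (f : 'I_n.+1 -> T -> T).
Hypothesis mf : forall a, measurable_fun [set: T] (f a).

(** Written as a measure, this side of a transfer identity can be compared with the invariant
    measure on a generating family only. *)
Definition pushforward_mixture : {measure set T -> \bar R} :=
  mixture p_ge0 (fun a =>
    measure_function_pushforward__canonical__measure_function_Measure m (mf a)).

Lemma pushforward_mixtureE D :
  pushforward_mixture D = \sum_a (p a)%:E * m (f a @^-1` D).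
Proof. by rewrite /pushforward_mixture mixtureE. Qed.

End pushforward_mixtures.

(* [f a] is the inverse branch of [T] whose values carry the label [a]. *)
Record branch_system {R : realType} {d} {X : measurableType d} {n : nat}
    (p : 'I_n.+1 -> R) (mu : {measure set X -> \bar R}) (T : X -> X)
    (f : 'I_n.+1 -> X -> X) (c : X -> 'I_n.+1) : Prop := BranchSystem {
  branch_weight_gt0 : forall a, 0 < p a;
  branch_weight_sum1 : \sum_a p a = 1;
  branch_mass1 : mu [set: X] = 1%E;
  measurable_map : measurable_fun [set: X] T;
  measurable_branch : forall a, measurable_fun [set: X] (f a);
  measurable_label : forall a, measurable (c @^-1` [set a]);
  branchK : forall a, cancel (f a) T;
  label_branch : forall a x, c (f a x) = a;
  branch_label : forall y, f (c y) (T y) = y;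
  transfer : forall D, measurable D ->
    (mu D = \sum_a (p a)%:E * mu (f a @^-1` D))%E }.

(** * Tree partitions, and visits to a set along the inverse branches *)

Section branch_systems.
Context {R : realType} {d} {X : measurableType d} {n : nat}.
Variables (p : 'I_n.+1 -> R) (mu : {measure set X -> \bar R}) (T : X -> X).
Variables (f : 'I_n.+1 -> X -> X) (c : X -> 'I_n.+1).
Hypothesis bs : branch_system p mu T f c.

Let p_ge0 a : 0 <= p a. Proof. exact/ltW/(branch_weight_gt0 bs). Qed.

Let measurable_preim a D : measurable D -> measurable (f a @^-1` D).
Proof. by move=> mD; rewrite -[_ @^-1` _]setTI; exact: (measurable_branch bs). Qed.

Let measurable_preimT D : measurable D -> measurable (T @^-1` D).
Proof. by move=> mD; rewrite -[_ @^-1` _]setTI; exact: (measurable_map bs). Qed.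

Let preim_preimT a D : f a @^-1` (T @^-1` D) = D.
Proof. by apply/seteqP; split => x /=; rewrite (branchK bs). Qed.

Lemma branch_system_preserving : measure_preserving mu T.
Proof.
split; first exact: (measurable_map bs).
move=> D mD; rewrite (transfer bs (measurable_preimT mD)).
rewrite (eq_bigr (fun a => (p a)%:E * mu D)%E) => [|a _]; last by rewrite preim_preimT.
rewrite -ge0_sume_distrl => [|a _]; last by rewrite lee_fin.
by rewrite sumEFin (branch_weight_sum1 bs) mul1e.
Qed.

Definition branch_law : R.-pker X ~> X :=
  branch_pkernel p_ge0 (measurable_branch bs) (branch_weight_sum1 bs).

Lemma preimage_law_branch : preimage_law mu T branch_law.
Proof.
move=> A C mA mC; under eq_integral do rewrite branch_kernelE.
have mAC := measurableI _ _ mA (measurable_preimT mC).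
rewrite (transfer bs mAC) ge0_integral_sum//; last first.
- by move=> a x _; rewrite mule_ge0// lee_fin.
- move=> a; apply: measurable_funeM; apply/measurable_EFinP.
  exact/measurable_indic/measurable_preim.
apply: eq_bigr => a _; rewrite ge0_integralZl_EFin//.
- by rewrite integral_indic ?preimage_setI ?preim_preimT//; exact: measurable_preim.
- by apply/measurable_EFinP/measurable_indic/measurable_preim.
Qed.

Lemma branch_law1 y : branch_law (T y) [set y] = (p (c y))%:E.
Proof.
rewrite branch_kernelE (bigD1 (c y))//= big1 => [|a ay].
  by rewrite indicE mem_set/= ?(branch_label bs)// mule1 adde0.
rewrite indicE memNset ?mule0//= => yE; move/eqP: ay; apply.
by rewrite -yE (label_branch bs).
Qed.

Lemma branch_label_bij x : set_bij (T @^-1` [set x]) [set: 'I_n.+1] c.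
Proof.
split=> //; first move=> y z /[!inE]/= Ty Tz yz.
  by rewrite -(branch_label bs y) Ty yz -Tz (branch_label bs).
by move=> a _; exists (f a x); rewrite ?(label_branch bs)//= (branchK bs).
Qed.

Lemma branch_tree_partition : tree_partition p mu T c.
Proof.
split; first exact: (measurable_label bs).
exists branch_law; first exact: preimage_law_branch.
apply: aeW => x; split; first exact: branch_label_bij.
by move=> y <-; exact: branch_law1.
Qed.

Lemma branch_n_to_one : n_to_one p mu T.
Proof.
have [_ [kappa law ae]] := branch_tree_partition.
by exists kappa => //; apply: filterS ae => x [cbij kc]; exists c.
Qed.

Definition branch_path (v : node n.+1) (x : X) : X := foldr f x v.

Lemma measurable_branch_path v : measurable_fun [set: X] (branch_path v).
Proof.
elim: v => [|a v IH]; first exact: measurable_id.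
by apply: measurableT_comp IH; exact: (measurable_branch bs).
Qed.

Let measurable_preim_path v D : measurable D -> measurable (branch_path v @^-1` D).
Proof. by move=> mD; rewrite -[_ @^-1` _]setTI; exact: measurable_branch_path. Qed.

(** Every [p a] is positive, so a vanishing sum in [transfer] forces each of its terms to have
    measure zero. *)
Lemma null_branch_path v N : measurable N -> mu N = 0%E ->
  mu (branch_path v @^-1` N) = 0%E.
Proof.
elim: v N => [//|a v IH] N mN N0.
apply: (IH (f a @^-1` N)); first exact: measurable_preim.
have := transfer bs mN; rewrite N0 => /esym/eqP.
rewrite seq_psume_eq0 => [|b _]; last by rewrite mule_ge0// lee_fin.
move=> /allP/(_ a); rewrite mem_index_enum => /(_ isT)/=.
by rewrite mule_eq0 eqe gt_eqF/= ?(branch_weight_gt0 bs)// => /eqP.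
Qed.

Lemma ae_branch_path (P : X -> Prop) : {ae mu, forall x, P x} ->
  {ae mu, forall x, forall v, P (branch_path v x)}.
Proof.
move=> [N [mN N0 PN]].
(* There are countably many nodes; [pickle] numbers them, so that countably many null sets can be
   united. *)
suff /ae_foralln : forall k, {ae mu, forall x,
    forall v : seq 'I_n.+1, pickle v = k -> P (branch_path v x)}.
  by apply: filterS => x Px v; exact: Px.
move=> k; have [[v vk]|nov] := pselect (exists v : seq 'I_n.+1, pickle v = k); last first.
  by apply: aeW => x v vk; case: nov; exists v.
have P_v x u : P (branch_path v x) -> pickle u = k -> P (branch_path u x).
  by move=> Pv; rewrite -vk => /(pcan_inj pickleK) ->.
exists (branch_path v @^-1` N); split.
- exact: measurable_preim_path.
- exact: null_branch_path.
- by move=> x /= nP; apply: PN => /= Px; apply: nP => u; exact: P_v.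
Qed.

Lemma transfer_path k D : measurable D ->
  mu D = (\sum_(v : k.-tuple 'I_n.+1) (weight p v)%:E * mu (branch_path v @^-1` D))%E.
Proof.
(* All measures are finite, so the identity can be moved to real numbers, where the recursion of
   [level_sum] applies. *)
have muE C : measurable C -> mu C = (fine (mu C))%:E.
  move=> mC; rewrite fineK// ge0_fin_numE//.
  apply: (@le_lt_trans _ _ 1%E); last by rewrite ltry.
  by rewrite -(branch_mass1 bs); apply: le_measure; rewrite ?inE.
move=> mD; rewrite (eq_bigr (fun v : k.-tuple 'I_n.+1 =>
    (weight p v * fine (mu (branch_path v @^-1` D)))%:E)) => [|v _]; last first.
  by rewrite EFinM -muE//; exact: measurable_preim_path.
rewrite sumEFin (muE D)//; congr EFin.
rewrite -[RHS]/(level_sum p k (fun v => fine (mu (branch_path v @^-1` D)))).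
elim: k D mD => [|k IH] D mD; first by rewrite level_sum0.
apply: EFin_inj; rewrite level_sumS -sumEFin -muE// (transfer bs mD).
apply: eq_bigr => a _; have mDa := measurable_preim a mD.
by rewrite (muE _ mDa) -EFinM (IH _ mDa).
Qed.

(** Both functions of [x] have integral [p a * mu C] over every measurable [C]: in [transfer] only
    the branch [a] meets the label [a]. The kernel is arbitrary so that the one supplied with
    another tree partition is covered. *)
Lemma label_law kappa : preimage_law mu T kappa ->
  forall a, {ae mu, forall x, kappa x (c @^-1` [set a]) = (p a)%:E}.
Proof.
move=> law a; have mca := measurable_label bs a.
suff : ae_eq mu [set: X] (cst (p a)%:E) (fun x => kappa x (c @^-1` [set a])).
  by apply: filterS => x /(_ I) /=.
apply: integral_ae_eq => //.
- apply/integrableP; split; first exact: measurable_cst.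
  by rewrite integral_cst// (branch_mass1 bs) mule1 ltry.
- exact: measurable_kernel.
move=> C _ mC; rewrite integral_cst// -law//.
rewrite (transfer bs (measurableI _ _ mca (measurable_preimT mC))).
rewrite (bigD1 a)//= big1 => [|b ba].
  rewrite adde0; congr (_ * mu _)%E; apply/seteqP; split => [x Cx|x /= []].
    by rewrite /= (label_branch bs) (branchK bs).
  by rewrite (branchK bs).
rewrite [X in mu X](_ : _ = set0) ?measure0 ?mule0//.
apply/seteqP; split => x //= []; rewrite (label_branch bs) => /eqP.
by rewrite (negbTE ba).
Qed.

Hypothesis measurable_set1 : forall y : X, measurable [set y].

(* A weight vector dominated by one of its rearrangements equals it; hence [K]
   relabels the branches by a weight-preserving permutation. *)
Lemma tree_partition_relabel K : tree_partition p mu T K ->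
  {ae mu, forall x, exists s : {perm 'I_n.+1},
    forall a, p (s a) = p a /\ branch T K (s a) x = f a x}.
Proof.
move=> [_ [kappa law aeK]].
have aec : {ae mu, forall x, forall a, kappa x (c @^-1` [set a]) = (p a)%:E}.
  suff /ae_foralln : forall k, {ae mu, forall x,
      forall a : 'I_n.+1, a = k :> nat -> kappa x (c @^-1` [set a]) = (p a)%:E}.
    by apply: filterS => x Px a; exact: Px.
  move=> k; apply: filterS (label_law law (inord k)) => x + a ak.
  by rewrite -ak inord_val.
apply: filterS2 aeK aec => x [[_ Kinj _] kK] kc.
have Kf_inj : injective (fun a => K (f a x)).
  move=> a b /Kinj; rewrite !inE /= !(branchK bs) => /(_ erefl erefl).
  by move/(congr1 c); rewrite !(label_branch bs).
pose s := perm Kf_inj; exists s => a.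
(* The point [f b x] has mass [p (K (f b x))], that is [p (s b)], and lies in the class of label
   [b], of mass [p b]. *)
have ps_le b : p (s b) <= p b.
  rewrite permE -lee_fin -kK ?(branchK bs)// -kc; apply: le_measure.
  - by rewrite inE.
  - by rewrite inE; exact: (measurable_label bs).
  - by move=> _ -> /=; rewrite (label_branch bs).
split.
  (* Nonnegative terms with sum zero all vanish. *)
  have : \sum_b (p b - p (s b)) = 0.
    by rewrite sumrB [X in X - _](reindex_inj (@perm_inj _ s)) subrr.
  move=> /(psumr_eq0P (P := xpredT)) h.
  by apply/esym/subr0_eq/h => // b _; rewrite subr_ge0.
(* The set contains [f a x], so [get] does not return its default; injectivity of [K] on the fibre
   identifies the chosen point. *)
have [] : [set y | T y = x /\ K y = s a] (branch T K (s a) x).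
  by apply: getPex; exists (f a x); split; rewrite ?(branchK bs) ?permE.
by move=> Tb Kb; apply: Kinj; rewrite ?inE/= ?(branchK bs)// Kb permE.
Qed.

(** Almost surely the relabelling exists at every point [branch_path v x] of the backward tree. One
    permutation chosen per node is exactly a twist. *)
Lemma tree_partition_twist K : tree_partition p mu T K ->
  {ae mu, forall x, exists2 s : node n.+1 -> {perm 'I_n.+1},
    forall v a, p (s v a) = p a &
    forall v, branches T K (twist s v) x = branch_path v x}.
Proof.
move=> /tree_partition_relabel/ae_branch_path; apply: filterS => x /choice[s sP].
exists s => [v a|]; first by have [] := sP v a.
by elim=> //= a v ->; have [] := sP v a.
Qed.

(** The expected number of visits to [E] in the first [m] steps of the random backward path from
    [x]. *)
Definition visits (m : nat) (E : set X) (x : X) : R :=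
  \sum_(1 <= k < m.+1) level_sum p k (fun v => \1_E (branch_path v x)).

Lemma measurable_visits m E : measurable E -> measurable_fun [set: X] (visits m E).
Proof.
move=> mE; apply: measurable_sum => k; apply: measurable_sum => v.
apply: measurable_funM; first exact: measurable_cst.
exact: measurable_indic (measurable_preim_path v mE).
Qed.

Lemma visits_ge0 m E x : 0 <= visits m E x.
Proof. by apply: sumr_ge0 => k _; apply: level_sum_ge0 => // v; rewrite indicE. Qed.

(** Stationarity: by [transfer_path] each of the [m] levels contributes [mu E]. *)
Lemma integral_visits m E : measurable E ->
  (\int[mu]_x (visits m E x)%:E = m%:R%:E * mu E)%E.
Proof.
move=> mE; pose F k x := (level_sum p k (fun v => \1_E (branch_path v x)))%:E.
have mF k (v : k.-tuple 'I_n.+1) :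
    measurable_fun [set: X] (fun x => (\1_(branch_path v @^-1` E) x)%:E : \bar R).
  exact/measurable_EFinP/measurable_indic/measurable_preim_path.
have intF k : (\int[mu]_x F k x = mu E)%E.
  rewrite (transfer_path k mE).
  under eq_integral do rewrite /F /level_sum -sumEFin.
  rewrite ge0_integral_sum//.
  - apply: eq_bigr => v _; under eq_integral do rewrite EFinM.
    rewrite (ge0_integralZl_EFin _ measurableT _ (mF k v) (weight_ge0 p_ge0 v))//.
    by rewrite integral_indic ?setIT//; exact: measurable_preim_path.
  - move=> v; under eq_fun do rewrite EFinM.
    exact: measurable_funeM (mF k v).
  - by move=> v x _; rewrite lee_fin mulr_ge0 ?weight_ge0// indicE.
under eq_integral do rewrite /visits -sumEFin.
rewrite ge0_integral_sum//.
- rewrite (eq_bigr (fun=> mu E)) => [|k _]; last exact: intF.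
  rewrite big_const_nat subn1 /=; elim: (m) => [|l IH]; first by rewrite mul0e.
  by rewrite iterS IH -nat1r EFinD ge0_muleDl ?lee_fin// mul1e.
- move=> k; apply/measurable_EFinP; apply: measurable_sum => v.
  apply: measurable_funM; first exact: measurable_cst.
  exact: measurable_indic (measurable_preim_path v mE).
- by move=> k x _; rewrite lee_fin; apply: level_sum_ge0 => // v; rewrite indicE.
Qed.

(** Markov's inequality: the mean number of visits is [m] times [mu E], at most [b * m * e]. *)
Lemma visits_rare m E (b e : R) : measurable E -> (0 < m)%N -> 0 < b ->
  (mu E <= (b * e)%:E)%E ->
  (mu [set x | (b * m%:R <= visits m E x)%R] <= e%:E)%E.
Proof.
move=> mE m0 b0 muE; have bm0 : 0 < b * m%:R by rewrite mulr_gt0// ltr0n.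
have := @le_integral_comp_abse _ _ _ mu setT measurableT (EFin \o visits m E)
  (b * m%:R) id.
rewrite setTI; under eq_integral do rewrite /= ger0_norm ?visits_ge0//.
rewrite integral_visits// => markov.
rewrite -(@lee_pmul2l _ (b * m%:R)%:E)//; apply: le_trans.
  rewrite [X in mu X](_ : _ = [set x | ((b * m%:R)%:E <= `|(EFin \o visits m E) x|)%E]).
    apply: markov => //; apply/measurable_EFinP; exact: measurable_visits.
  by apply/seteqP; split => x /=; rewrite lee_fin ger0_norm ?visits_ge0.
rewrite -EFinM mulrAC EFinM muleC; apply: lee_wpmul2r => //.
Qed.

End branch_systems.

(** * Skew products over Bernoulli shifts *)

Section bernoulli_words.
Context {R : realType} {n : nat} (p : 'I_n.+1 -> R).

Definition scons {A : Type} (a : A) (x : nat -> A) : nat -> A :=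
  fun k => if k is l.+1 then x l else a.

Lemma scons_shift {A : Type} (x : nat -> A) : scons (x 0%N) (Defs.shift x) = x.
Proof. by apply/funext => -[]. Qed.

Lemma measurable_coordinate (k : nat) (a : 'I_n.+1) :
  measurable ([set x | x k = a] : set (words n)).
Proof. by apply: sub_sigma_algebra; exists k, a. Qed.

Lemma measurable_words (f : words n -> words n) :
  (forall k a, measurable (f @^-1` [set x | x k = a])) -> measurable_fun [set: words n] f.
Proof.
move=> mf; apply: (@measurability _ _ (words n) (words n) _ _ (@coordinate_sets n)) => //.
by move=> _ [_ [k [a ->]] <-]; rewrite setTI.
Qed.

Lemma measurable_scons a : measurable_fun [set: words n] (scons a : words n -> words n).
Proof.
apply: measurable_words => -[|k] b; last exact: (measurable_coordinate k b).
have [ab|ab] := eqVneq a b.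
  rewrite (_ : _ @^-1` _ = setT)//.
  by apply/seteqP; split => x //= _.
rewrite (_ : _ @^-1` _ = set0)//.
by apply/seteqP; split => x //= /eqP; rewrite (negbTE ab).
Qed.

Lemma measurable_shift : measurable_fun [set: words n] (Defs.shift : words n -> words n).
Proof. by apply: measurable_words => k a; exact: (measurable_coordinate k.+1 a). Qed.

Definition cylinder (v : node n.+1) : set (words n) :=
  [set x | forall k, (k < size v)%N -> x k = nth ord0 v k].

Lemma cylinder_nil : cylinder [::] = [set: words n].
Proof. by apply/seteqP; split. Qed.

Lemma cylinder_cons a v :
  cylinder (a :: v) = [set x | x 0%N = a] `&` Defs.shift @^-1` cylinder v.
Proof.
apply/seteqP; split => [x xv|x [x0 xv] [|k]//]; last exact: xv.
by split => [|k kv]; [exact: (xv 0%N)|exact: (xv k.+1)].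
Qed.

Lemma measurable_cylinder v : measurable (cylinder v).
Proof.
elim: v => [|a v IH]; first by rewrite cylinder_nil.
rewrite cylinder_cons; apply: measurableI; first exact: measurable_coordinate.
by rewrite -[_ @^-1` _]setTI; exact: measurable_shift.
Qed.

Lemma scons_cylinder a b v :
  scons a @^-1` cylinder (b :: v) = if a == b then cylinder v else set0.
Proof.
rewrite cylinder_cons preimage_setI.
case: eqP => [->|ab]; apply/seteqP; split => x //=; first by case.
by case.
Qed.

(** Two cylinders are nested or disjoint; adding the empty set makes the family stable under
    intersection. *)
Definition cylinders : set (set (words n)) :=
  [set C | C = set0 \/ exists v, C = cylinder v].

Lemma cylinders_setI : setI_closed cylinders.
Proof.
have cyl v w : cylinders (cylinder v `&` cylinder w).
  elim: v w => [|a v IH] [|b w].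
  - by right; exists [::]; rewrite setIid.
  - by right; exists (b :: w); rewrite cylinder_nil setTI.
  - by right; exists (a :: v); rewrite cylinder_nil setIT.
  have [<-|ab] := eqVneq a b; last first.
    left; apply/seteqP; split => x //= [/(_ 0%N isT)/= xa /(_ 0%N isT)/= xb].
    by move: ab; rewrite -xa -xb eqxx.
  have := IH w => -[vw|[u vw]].
    left; rewrite !cylinder_cons -subset0 => x [[_ xv] [_ xw]].
    by have : (cylinder v `&` cylinder w) (Defs.shift x) by []; rewrite vw.
  right; exists (a :: u); rewrite !cylinder_cons -vw preimage_setI.
  by rewrite setIACA setIid.
move=> _ _ [->|[v ->]] [->|[w ->]]; rewrite ?set0I ?setI0; [by left..|].
exact: cyl.
Qed.

Lemma cylinders_generate : (measurable : set (set (words n))) = <<s cylinders >>.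
Proof.
apply/seteqP; split; apply: smallest_sub; try exact: smallest_sigma_algebra; last first.
  move=> _ [->|[v ->]]; first exact: measurable0.
  exact: measurable_cylinder.
move=> _ [k [a ->]].
(* The shift is measurable for this sigma-algebra too, since the preimage of a cylinder is a finite
   union of cylinders. This reduces coordinate [k.+1] to coordinate [k]. *)
pose W : measurableType _ := g_sigma_algebraType cylinders.
suff: measurable ([set x | x k = a] : set W) by [].
elim: k => [|k IH].
  apply: sub_sigma_algebra; right; exists [:: a]; rewrite cylinder_cons cylinder_nil.
  by rewrite preimage_setT setIT.
have mshift : measurable_fun [set: W] (Defs.shift : W -> W).
  apply: (@measurability _ _ W W _ _ cylinders) => // _ [C cC <-]; rewrite setTI.
  case: cC => [->|[v ->]]; first by rewrite preimage_set0.
  rewrite (_ : _ @^-1` _ = \bigcup_(b in [set: 'I_n.+1]) cylinder (b :: v)).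
    apply: fin_bigcup_measurable => // b _.
    by apply: sub_sigma_algebra; right; exists (b :: v).
  apply/seteqP; split => [x xv|x [b _]]; last by rewrite cylinder_cons => -[].
  by exists (x 0%N) => //; rewrite cylinder_cons.
by have := mshift measurableT _ IH; rewrite setTI.
Qed.

Hypothesis p_ge0 : forall a, 0 <= p a.
Hypothesis p_sum1 : \sum_a p a = 1.
Variable mu : probability (words n) R.
Hypothesis mu_bernoulli : is_bernoulli p mu.

(** Both sides are measures, and they agree on cylinders because prefixing [b] multiplies the weight
    by [p b]. *)
Lemma bernoulli_transfer (A : set (words n)) : measurable A ->
  (mu A = \sum_a (p a)%:E * mu (scons a @^-1` A))%E.
Proof.
rewrite -(pushforward_mixtureE p_ge0 mu measurable_scons).
apply: (measure_unique cylinders (fun=> setT)).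
- exact: cylinders_generate.
- exact: cylinders_setI.
- by move=> _; right; exists [::]; rewrite cylinder_nil.
- by apply/seteqP; split => // x _; exists 0%N.
- move=> _ [->|[[|b v] ->]]; first by rewrite !measure0.
    rewrite cylinder_nil pushforward_mixtureE.
    rewrite (eq_bigr (fun a => (p a)%:E)) => [|a _].
      by rewrite sumEFin p_sum1; exact: probability_setT.
    by rewrite preimage_setT [X in (_ * X)%E]probability_setT mule1.
  rewrite pushforward_mixtureE (bigD1 b)//= big1 => [|a ab].
    rewrite scons_cylinder eqxx adde0 [LHS]mu_bernoulli [X in (_ * X)%E]mu_bernoulli.
    by rewrite /weight big_cons EFinM.
  by rewrite scons_cylinder (negbTE ab) measure0 mule0.
- by move=> _; rewrite [X in (X < _)%E]probability_setT ltry.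
Qed.

End bernoulli_words.

(** * Compact groups with an invariant metric *)

Section invariant_metrics.
Context {R : realType} {G : topologicalZmodType} (dist : G -> G -> R).
Hypothesis dist_inv : invariant_metric dist.

Let dist_ge0 x y : 0 <= dist x y. Proof. by have [[]] := dist_inv. Qed.

Let dist_triangle y x z : dist x z <= dist x y + dist y z.
Proof. by have [[_ _ _]] := dist_inv; exact. Qed.

Let distC x y : dist x y = dist y x. Proof. by have [[]] := dist_inv. Qed.

Let dist0P x y : dist x y = 0 <-> x = y. Proof. by have [[_]] := dist_inv. Qed.

Let nbhs_distP (x : G) (U : set G) :
  nbhs x U <-> exists2 e : R, 0 < e & [set y | dist x y < e] `<=` U.
Proof. by have [_ []] := dist_inv. Qed.

Lemma invariant_distB x y : dist x y = dist (x - y) 0.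
Proof.
by have [_ [_ inv]] := dist_inv; rewrite -(inv (- y)) addNr addrC.
Qed.

Lemma open_dist_ball x e : open ([set y | dist x y < e] : set G).
Proof.
rewrite openE => y /= xy; apply/nbhs_distP; exists (e - dist x y).
  by rewrite subr_gt0.
by move=> z /=; rewrite ltrBrDl; apply: le_lt_trans; exact: dist_triangle.
Qed.

Lemma open_dist_setC1 x : open (~` [set x] : set G).
Proof.
rewrite openE => y /= yx; apply/nbhs_distP; exists (dist y x).
  by rewrite lt_neqAle dist_ge0 andbT eq_sym; apply/eqP => /dist0P.
by move=> z /= + zx; rewrite zx ltxx.
Qed.

Lemma measurable_borel_set1 x : measurable ([set x] : set (borel G)).
Proof.
rewrite -[X in measurable X]setCK; apply: measurableC.
by apply: sub_sigma_algebra; exact: open_dist_setC1.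
Qed.

Lemma measurable_addr (a : G) :
  measurable_fun [set: borel G] (fun x : borel G => ((x : G) + a) : borel G).
Proof.
apply: (@measurability _ _ (borel G) (borel G) _ _ (@open G)) => //.
move=> _ [U oU <-]; rewrite setTI; apply: sub_sigma_algebra.
rewrite openE => x /= Uxa; apply/nbhs_distP.
have /nbhs_distP[e e0 eU] : nbhs (x + a) U by exact: open_nbhs_nbhs.
exists e => // y /= xy; apply: eU.
by have [_ [_ inv]] := dist_inv; rewrite /= ![_ + a]addrC inv.
Qed.

Hypothesis G_compact : compact [set: G].

(* Compactness makes the number of steps needed to come close to [0]
   independent of the starting point. *)
Lemma dense_orbit_reach (a : G) (e : R) : 0 < e ->
  dense [set a *+ k | k in [set: nat]] ->
  exists m, forall d, exists2 k, (k <= m)%N & dist (d + a *+ k) 0 < e.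
Proof.
move=> e0 a_dense.
have /compact_near_coveringP := G_compact.
move=> /(_ nat \oo (fun m d => exists2 k, (k <= m)%N & dist (d + a *+ k) 0 < e)).
case=> [|m _ mP]; last by exists m => d; exact: (mP m (leqnn m) d I).
move=> x _.
(* Density gives [k] with [a *+ k] within [e] of [- x]; the same [k] serves a whole neighbourhood of
   [x]. *)
have [] := a_dense [set y | dist (- x) y < e].
- by exists (- x); rewrite /= (iffRL (dist0P _ _) erefl).
- exact: open_dist_ball.
move=> y [xk [k _ kE]]; move: xk; rewrite -kE /= {y kE} => xk.
have dE y : dist (y + a *+ k) 0 = dist (- y) (a *+ k).
  by have [_ [_ inv]] := dist_inv; rewrite -(inv y (- y)) subrr distC.
exists ([set y | dist (y + a *+ k) 0 < e], [set m | (k <= m)%N]).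
  split; last by exists k.
  apply/nbhs_distP; exists (e - dist (- x) (a *+ k)); first by rewrite subr_gt0.
  move=> y /=; rewrite ltrBrDr; apply: le_lt_trans.
  rewrite dE; apply: le_trans (dist_triangle (- x) _ _) _; rewrite lerD2r.
  by rewrite invariant_distB opprK addrC -invariant_distB.
by move=> [y m] [/= yk km]; exists k.
Qed.

End invariant_metrics.

(** * The skew product and its inverse branches *)

Section skew_products.
Context {R : realType} {n : nat} {G : topologicalZmodType}.
Variables (p : 'I_n.+1 -> R) (dist : G -> G -> R) (nu : probability (borel G) R).
Variables (g : 'I_n.+1 -> G) (mu : probability (words n) R).
Hypotheses (p_gt0 : forall a, 0 < p a) (p_sum1 : \sum_a p a = 1).
Hypotheses (dist_inv : invariant_metric dist) (nu_haar : is_haar nu).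
Hypothesis mu_bernoulli : is_bernoulli p mu.

Definition skew_branch (a : 'I_n.+1) (z : words n * borel G) : words n * borel G :=
  (scons a z.1, (z.2 : G) - g a).

Definition first_symbol (z : words n * borel G) : 'I_n.+1 := z.1 0%N.

Lemma measurable_first_symbol a :
  measurable (first_symbol @^-1` [set a]).
Proof.
rewrite (_ : _ @^-1` _ = setT `&` fst @^-1` ([set x | x 0%N = a] : set (words n))).
  by apply: measurable_fst => //; exact: measurable_coordinate.
by rewrite setTI.
Qed.

Lemma measurable_skew_shift : measurable_fun setT (skew_shift g).
Proof.
apply: measurable_fun_pair.
  exact: (measurableT_comp measurable_shift measurable_fst).
move=> _ B mB; rewrite setTI.
(* The translation in the second coordinate depends only on the first symbol, which takes finitely
   many values. *)
rewrite (_ : _ @^-1` _ = \bigcup_(a in [set: 'I_n.+1])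
    (first_symbol @^-1` [set a] `&`
     snd @^-1` ((fun x : borel G => ((x : G) + g a) : borel G) @^-1` B))).
  apply: fin_bigcup_measurable => // a _; apply: measurableI.
    exact: measurable_first_symbol.
  rewrite -[X in measurable X]setTI; apply: measurable_snd => //.
  by rewrite -[X in measurable X]setTI; exact: (measurable_addr dist_inv).
apply/seteqP; split => [z Bz|z [a _ [/= <-]]//].
by exists (first_symbol z).
Qed.

Lemma measurable_skew_branch a : measurable_fun setT (skew_branch a).
Proof.
apply: measurable_fun_pair.
  exact: (measurableT_comp (measurable_scons a) measurable_fst).
exact: (measurableT_comp (measurable_addr dist_inv (- g a)) measurable_snd).
Qed.

Let p_ge0 a : 0 <= p a. Proof. exact: ltW. Qed.

(** Rectangles determine the measure. On them the word factor obeys [bernoulli_transfer], and Haar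
    measure absorbs the translation by [- g a]. *)
Lemma skew_transfer (D : set (words n * borel G)) : measurable D ->
  ((mu \x nu) D = \sum_a (p a)%:E * (mu \x nu) (skew_branch a @^-1` D))%E.
Proof.
rewrite -(pushforward_mixtureE p_ge0 (mu \x nu)%E measurable_skew_branch).
apply: product_measure_unique => A B mA mB.
rewrite pushforward_mixtureE.
rewrite [X in _ = (X * _)%E](bernoulli_transfer p_ge0 p_sum1 mu_bernoulli mA).
rewrite ge0_sume_distrl => [|a _]; last by rewrite mule_ge0 ?lee_fin.
apply: eq_bigr => a _; rewrite -muleA; congr (_ * _)%E.
rewrite (_ : _ @^-1` _ = (scons a @^-1` A) `*`
    ((fun x : borel G => ((x : G) - g a) : borel G) @^-1` B))//.
rewrite [LHS]product_measure1E.
- congr (_ * _)%E; rewrite -[RHS](nu_haar (- g a) mB); congr (nu _).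
  by apply/seteqP; split => x /=; rewrite addrC.
- by rewrite -[X in measurable X]setTI; exact: measurable_scons.
- by rewrite -[X in measurable X]setTI; exact: (measurable_addr dist_inv).
Qed.

Lemma product_setT : (mu \x nu)%E [set: words n * borel G] = 1%E.
Proof.
have lambda1 := @product_measure1E _ _ _ _ _ mu nu setT setT measurableT measurableT.
rewrite setXTT in lambda1; refine (etrans lambda1 _).
by rewrite [X in (X * _)%E]probability_setT mul1e; exact: probability_setT.
Qed.

Lemma skew_branch_system :
  branch_system p (mu \x nu)%E (skew_shift g) skew_branch first_symbol.
Proof.
split => //.
- exact: product_setT.
- exact: measurable_skew_shift.
- exact: measurable_skew_branch.
- exact: measurable_first_symbol.
- by move=> a [x h]; rewrite /skew_shift /skew_branch /= subrK.
- by move=> [x h]; rewrite /skew_shift /skew_branch /= scons_shift addrK.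
- exact: skew_transfer.
Qed.

Lemma measurable_skew_set1 (z : words n * borel G) : measurable [set z].
Proof.
rewrite (_ : [set z] = [set z.1] `*` [set z.2]).
  apply: measurableX; last exact: (measurable_borel_set1 dist_inv).
  rewrite (_ : [set z.1] = \bigcap_k [set x : words n | x k = z.1 k]).
    by apply: bigcapT_measurable => k; exact: measurable_coordinate.
  apply/seteqP; split => [_ -> k _//|x xz]; apply/funext => k; exact: xz.
apply/seteqP; split => [_ -> //|[x h] /= [-> ->]]; by case: z.
Qed.

Lemma skew_pathE v (z : words n * borel G) :
  branch_path skew_branch v z =
  (foldr scons (z.1 : nat -> 'I_n.+1) v, (z.2 : G) - displacement g v).
Proof.
elim: v => [|a v IH].
  by rewrite /displacement big_nil subr0; case: z.
rewrite /branch_path /= -/(branch_path _ _ _) IH /skew_branch /=.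
by rewrite /displacement big_cons opprD addrA [(z.2 : G) - g a - _]addrAC.
Qed.

(** * Measurable sets are nearly determined by a prefix and an approximate group coordinate *)

Definition close_points (r : nat) (e : R) (z z' : words n * borel G) : Prop :=
  (forall k, (k < r)%N -> z.1 k = z'.1 k) /\ dist z.2 z'.2 < e.

(** A Lusin property: off a set of small measure, membership in [P] does not distinguish close
    points. *)
Definition almost_local (P : set (words n * borel G)) : Prop :=
  forall e, 0 < e -> exists r delta E, [/\ 0 < delta, measurable E,
    ((mu \x nu) E <= e%:E)%E &
    forall z z', close_points r delta z z' -> ~ E z -> ~ E z' -> P z <-> P z'].

Lemma close_points_le r r' e e' z z' : (r <= r')%N -> e' <= e ->
  close_points r' e' z z' -> close_points r e z z'.
Proof.
move=> rr ee [zz' d]; split; last exact: lt_le_trans ee.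
by move=> k kr; apply: zz'; exact: leq_trans rr.
Qed.

Lemma close_pointsC r e z z' : close_points r e z z' -> close_points r e z' z.
Proof.
have [[_ _ distC _] _] := dist_inv.
by move=> [zz' d]; split; [move=> k kr; rewrite zz'|rewrite distC].
Qed.

Lemma almost_localC P : almost_local P -> almost_local (~` P).
Proof.
move=> lP e /lP[r [delta [E [d0 mE lE EP]]]].
exists r, delta, E; split => // z z' zz' Ez Ez'.
by have [h1 h2] := EP z z' zz' Ez Ez'; split; exact: contra_not.
Qed.

Lemma almost_local0 : almost_local set0.
Proof.
by move=> e e0; exists 0%N, 1, set0; split => //; rewrite measure0 lee_fin ltW.
Qed.

(* The symmetric difference of [P] and its approximation is discarded. *)
Lemma almost_local_approx P : (forall e, 0 < e -> exists Q D,
    [/\ almost_local Q, measurable D, ((mu \x nu) D <= e%:E)%E &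
        forall z, ~ D z -> P z <-> Q z]) -> almost_local P.
Proof.
move=> PQ e e0; have e20 : 0 < e / 2 by rewrite divr_gt0.
have [Q [D [lQ mD lD DP]]] := PQ _ e20.
have [r [delta [E [d0 mE lE EQ]]]] := lQ _ e20.
exists r, delta, (E `|` D); split => //; first exact: measurableU.
  rewrite (splitr e) EFinD; apply: le_trans (measureU2 _ mE mD) _.
  exact: leeD.
move=> z z' zz' /not_orP[Ez Dz] /not_orP[Ez' Dz'].
by rewrite DP// DP//; exact: EQ.
Qed.

Lemma almost_localU P Q : almost_local P -> almost_local Q -> almost_local (P `|` Q).
Proof.
move=> lP lQ e e0; have e20 : 0 < e / 2 by rewrite divr_gt0.
have [r [delta [E [d0 mE lE EP]]]] := lP _ e20.
have [r' [delta' [E' [d0' mE' lE' EQ]]]] := lQ _ e20.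
exists (maxn r r'), (Order.min delta delta'), (E `|` E'); split.
- by rewrite lt_min d0.
- exact: measurableU.
- by rewrite (splitr e) EFinD; apply: le_trans (measureU2 _ mE mE') _; exact: leeD.
move=> z z' zz' /not_orP[Ez E'z] /not_orP[Ez' E'z'].
have cl : close_points r delta z z'.
  by apply: close_points_le zz'; rewrite ?leq_maxl ?ge_min ?lexx.
have cl' : close_points r' delta' z z'.
  by apply: close_points_le zz'; rewrite ?leq_maxr ?ge_min ?lexx ?orbT.
by rewrite /setU /= (EP z z')// (EQ z z').
Qed.

Let fin_measure (D : set (words n * borel G)) : measurable D ->
  ((mu \x nu) D < +oo)%E.
Proof.
move=> mD; apply: (@le_lt_trans _ _ 1%E); last by rewrite ltry.
by rewrite -product_setT; apply: le_measure; rewrite ?inE.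
Qed.

Let small_tail (D : nat -> set (words n * borel G)) (e : R) : 0 < e ->
  (forall k, measurable (D k)) -> {homo D : k l / (k <= l)%N >-> (l <= k)%O} ->
  \bigcap_k D k = set0 -> exists k, ((mu \x nu) (D k) <= e%:E)%E.
Proof.
move=> e0 mD Ddec D0.
have := @nonincreasing_cvg_mu _ _ _ (mu \x nu)%E D (fin_measure (mD 0%N)) mD.
rewrite D0 measure0 => /(_ measurable0 Ddec).
move=> /(_ [set x | (x < e%:E)%E])[|k _ kD].
  by apply: open_nbhs_nbhs; split; [exact: open_ereal_lt_ereal|rewrite /= lte_fin].
by exists k; apply/ltW/(kD k); rewrite /= leqnn.
Qed.

(** By continuity from above, a finite union exhausts the countable one up to small measure. *)
Lemma almost_local_bigcup (P : nat -> set (words n * borel G)) :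
  (forall k, measurable (P k)) -> (forall k, almost_local (P k)) ->
  almost_local (\bigcup_k P k).
Proof.
move=> mP lP; apply: almost_local_approx => e e0.
pose U k := \big[setU/set0]_(l < k) P l.
have mU k : measurable (U k) by apply: bigsetU_measurable.
have lU k : almost_local (U k).
  elim: k => [|k IH]; first by rewrite /U big_ord0; exact: almost_local0.
  by rewrite /U big_ord_recr /=; exact: almost_localU.
have mbig : measurable (\bigcup_k P k) by exact: bigcupT_measurable.
have [k lk] : exists k, ((mu \x nu) (\bigcup_k P k `\` U k) <= e%:E)%E.
  apply: small_tail => //.
  - by move=> k; exact: measurableD.
  - move=> k l kl; apply/subsetPset; apply: setDS.
    by rewrite /U -!bigcup_mkord => z [i /= ik Piz]; exists i => //=; exact: leq_trans kl.
  - rewrite -subset0 => z zD; have [[i _ Pi] _] := zD 0%N I.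
    have [_] := zD i.+1 I; apply; rewrite /U -bigcup_mkord; exists i => //=.
exists (U k), (\bigcup_k P k `\` U k); split => //; first exact: measurableD.
move=> z; rewrite /setD /= => /not_andP nD; split => [Pz|].
  by case: nD => // /contrapT.
by rewrite /U -bigcup_mkord => -[i _ Piz]; exists i.
Qed.

Lemma almost_local_coordinate k a : almost_local (fst @^-1` [set x | x k = a]).
Proof.
move=> e e0; exists k.+1, 1, set0; split => //; first by rewrite measure0 lee_fin ltW.
by move=> z z' [zz' _] _ _ /=; rewrite zz'.
Qed.

(* The discarded set is the part of [U] within [1/k] of its complement. *)
Lemma almost_local_open (U : set G) : open U ->
  almost_local (snd @^-1` (U : set (borel G))).
Proof.
have [[_ _ distC _] [nbhs_distP _]] := dist_inv.
move=> oU e e0.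
pose V k : set (borel G) := [set x | exists2 y, ~ U y & dist y x < k.+1%:R^-1].
have mU : measurable (U : set (borel G)) by exact: sub_sigma_algebra.
have mV k : measurable (V k).
  apply: sub_sigma_algebra; rewrite (_ : V k =
      \bigcup_(y in ~` U) ([set x | dist y x < k.+1%:R^-1] : set G)).
    by apply: bigcup_open => y _; exact: (open_dist_ball dist_inv).
  by apply/seteqP; split => x [y]; exists y.
pose D k : set (words n * borel G) := snd @^-1` (U `&` V k).
have [k lk] : exists k, ((mu \x nu) (D k) <= e%:E)%E.
  apply: small_tail => //.
  - move=> k; rewrite -[X in measurable X]setTI; apply: measurable_snd => //.
    exact: measurableI.
  - move=> k l kl; apply/subsetPset => z [Uz [y Uy yz]]; split => //; exists y => //.
    apply: lt_le_trans yz _; rewrite lef_pV2 ?posrE ?ltr0n// ler_nat.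
    exact: kl.
  - rewrite -subset0 => z zD; have [Uz _] := zD 0%N I.
    (* A point of the open set [U] has a ball of radius [d] inside [U], hence leaves [V k] once
       [k.+1%:R^-1 < d]. *)
    have /nbhs_distP[d d0 dU] : nbhs (z.2 : G) U by exact: open_nbhs_nbhs.
    have [k _ kd] := near_infty_natSinv_lt (PosNum d0).
    have [_ [y Uy yz]] := zD k I; apply: Uy; apply: dU => /=.
    by rewrite distC; apply: lt_trans yz _; exact: (kd k (leqnn k)).
exists 0%N, k.+1%:R^-1, (D k); split => //.
  rewrite -[X in measurable X]setTI; apply: measurable_snd => //.
  exact: measurableI.
have half z z' : close_points 0 k.+1%:R^-1 z z' -> ~ D k z -> U z.2 -> U z'.2.
  move=> [_ zz'] nD Uz; apply: contrapT => Uz'; apply: nD; split => //.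
  by exists z'.2 => //; rewrite distC.
move=> z z' zz' Dz Dz'; split; first exact: half zz' Dz.
exact: half (close_pointsC zz') Dz'.
Qed.

(** The measurable almost local sets form a sigma-algebra that contains the coordinate sets and the
    open sets of the group. *)
Lemma measurable_almost_local (P : set (words n * borel G)) :
  measurable P -> almost_local P.
Proof.
pose L := [set P : set (words n * borel G) | measurable P /\ almost_local P].
have L_sigma : sigma_algebra [set: words n * borel G] L.
  split.
  - by split; [exact: measurable0|exact: almost_local0].
  - by move=> A [mA lA]; rewrite setTD; split; [exact: measurableC|exact: almost_localC].
  - move=> A LA; split; first by apply: bigcupT_measurable => k; have [] := LA k.
    by apply: almost_local_bigcup => k; have [] := LA k.
suff : measurable `<=` L by move=> h /h[].
(* Pulled back along each projection, [L] need only be checked on the generators of that factor. *)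
have preimL T (f : words n * borel G -> T) :
    sigma_algebra [set: T] [set A | L (f @^-1` A)].
  have [L0 LC LU] := L_sigma; split => /=.
  - by rewrite preimage_set0.
  - by move=> A LA; have := LC _ LA; rewrite !setTD preimage_setC.
  - by move=> A LA; rewrite preimage_bigcup; exact: LU.
apply: smallest_sub => //; rewrite subUset; split => _ [A mA <-]; rewrite setTI.
- move: A mA; apply: smallest_sub; first exact: preimL.
  move=> _ [k [a ->]]; split; last exact: almost_local_coordinate.
  rewrite -[X in measurable X]setTI.
  by apply: measurable_fst => //; exact: measurable_coordinate.
- move: A mA; apply: smallest_sub; first exact: preimL.
  move=> A oA; split; last exact: almost_local_open.
  rewrite -[X in measurable X]setTI.
  by apply: measurable_snd => //; exact: sub_sigma_algebra.
Qed.

End skew_products.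

(** * Tree names of functions on the skew product *)

Section compact_metrics.
Context {R : realType} {Y : metricType R}.
Hypothesis Y_compact : compact [set: Y].

Let nbhs_mball (y : Y) (e : R) : 0 < e -> nbhs y [set z | mdist y z < e].
Proof. by move=> e0; rewrite -ballEmdist; exact: nbhsx_ballx. Qed.

Lemma compact_mdist_bounded : exists2 b : R, 0 < b & forall y z : Y, mdist y z <= b.
Proof.
have [[y0 _]|Y0] := pselect ([set: Y] !=set0); last first.
  by exists 1 => // y; case: Y0; exists y.
have /compact_near_coveringP := Y_compact.
move=> /(_ nat \oo (fun m y => mdist y0 y <= m%:R)) [y _|m _ mP].
  have [k _ kP] := nbhs_infty_ger (mdist y0 y + 1).
  exists ([set z | mdist y z < 1], [set m | (k <= m)%N]).
    by split; [exact: nbhs_mball|exists k].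
  move=> [z m] [/= yz km]; apply: le_trans (kP _ km).
  by apply: le_trans (metric_triangle y0 y z) _; rewrite lerD2l ltW.
exists (m.+1%:R + m.+1%:R); first by rewrite addr_gt0.
have bnd y : mdist y0 y <= m.+1%:R.
  by apply: le_trans (mP m (leqnn m) y I) _; rewrite ler_nat.
move=> y z; apply: le_trans (metric_triangle y y0 z) _.
by rewrite lerD// metric_sym.
Qed.

Lemma compact_finite_net (e : R) : 0 < e ->
  exists s : seq Y, forall y, exists2 c, c \in s & mdist c y < e.
Proof.
move=> e0.
(* Along the filter of ever larger finite lists, every point is eventually covered locally;
   compactness yields one list for all points. *)
pose F := filter_from [set: seq Y] (fun s => [set t : seq Y | {subset s <= t}]).
have FF : Filter F.
  apply: filter_from_filter; first by exists [::].
  move=> s t _ _; exists (s ++ t) => // u stu.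
  by split => x xs; apply: stu; rewrite mem_cat xs ?orbT.
have /compact_near_coveringP := Y_compact.
move=> /(_ _ F (fun s y => exists2 c, c \in s & mdist c y < e)) [y _|s _ sP].
  exists ([set z | mdist y z < e], [set s : seq Y | {subset [:: y] <= s}]).
    by split; [exact: nbhs_mball|exists [:: y]].
  by move=> [z s] [/= yz ys]; exists y => //; apply: ys; rewrite mem_head.
by exists s => y; exact: (sP s (fun=> id) y I).
Qed.

Lemma open_mball (y : Y) (e : R) : open [set z | mdist y z < e].
Proof.
rewrite openE => z /= yz; have d0 : 0 < e - mdist y z by rewrite subr_gt0.
apply: filterS (nbhs_mball z d0) => x /=; rewrite ltrBrDl; apply: le_lt_trans.
exact: metric_triangle.
Qed.

End compact_metrics.

Lemma sum_lt_le m l : (\sum_(1 <= k < m.+1) (k < l) <= l)%N.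
Proof.
(* The bound [l] alone is not inductive; the minimum with [m] is. *)
suff : (\sum_(1 <= k < m.+1) (k < l) <= minn m l)%N.
  by move/leq_trans; apply; exact: geq_minr.
elim: m => [|m IH]; first by rewrite big_nil.
by rewrite big_nat_recr//=; lia.
Qed.

(** * Tree distance between typical points *)

Section very_weak_bernoulli.
Context {R : realType} {n : nat} {G : topologicalZmodType}.
Variables (p : 'I_n.+1 -> R) (dist : G -> G -> R) (nu : probability (borel G) R).
Variables (g : 'I_n.+1 -> G) (mu : probability (words n) R).
Hypotheses (p_gt0 : forall a, 0 < p a) (p_sum1 : \sum_a p a = 1).
Hypotheses (dist_inv : invariant_metric dist) (nu_haar : is_haar nu).
Hypothesis mu_bernoulli : is_bernoulli p mu.

Let p_ge0 a : 0 <= p a. Proof. exact: ltW. Qed.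

Let bs := skew_branch_system g p_gt0 p_sum1 dist_inv nu_haar mu_bernoulli.

Lemma almost_local_seq (I : eqType) (s : seq I) (P : I -> set (words n * borel G)) :
  (forall i, measurable (P i)) -> forall e, 0 < e ->
  exists r delta E, [/\ 0 < delta, measurable E,
    ((mu \x nu) E <= e%:E)%E &
    forall z z', close_points dist r delta z z' -> ~ E z -> ~ E z' ->
      forall i, i \in s -> P i z -> P i z'].
Proof.
move=> mP; elim: s => [|i s IH] e e0.
  by exists 0%N, 1, set0; split => //; rewrite measure0 lee_fin ltW.
have e20 : 0 < e / 2 by rewrite divr_gt0.
have [r [d [E [d0 mE lE EP]]]] := IH _ e20.
have [r' [d' [E' [d0' mE' lE' EP']]]] :=
  measurable_almost_local nu mu dist_inv (mP i) e20.
exists (maxn r r'), (Order.min d d'), (E `|` E'); split.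
- by rewrite lt_min d0.
- exact: measurableU.
- by rewrite (splitr e) EFinD; apply: le_trans (measureU2 _ mE mE') _; exact: leeD.
move=> z z' zz' /not_orP[Ez E'z] /not_orP[Ez' E'z'] k.
rewrite inE => /predU1P[->|ks].
  apply: (EP' z z' _ E'z E'z').1; apply: close_points_le zz'.
    by rewrite leq_maxr.
  by rewrite ge_min lexx orbT.
by apply: EP ks => //; apply: close_points_le zz'; rewrite ?leq_maxl ?ge_min ?lexx.
Qed.

(** A finite net of mesh [eta / 2] reduces the claim to finitely many preimages of balls: close
    points outside [E] fall into a common one. *)
Lemma almost_local_fun (Y : metricType R) (h : words n * borel G -> Y) :
  compact [set: Y] -> borel_measurable h -> forall eta e, 0 < eta -> 0 < e ->
  exists r delta E, [/\ 0 < delta, measurable E,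
    ((mu \x nu) E <= e%:E)%E &
    forall z z', close_points dist r delta z z' -> ~ E z -> ~ E z' ->
      mdist (h z) (h z') < eta].
Proof.
move=> Y_compact mh eta e eta0 e0.
have eta20 : 0 < eta / 2 by rewrite divr_gt0.
have [s sP] := compact_finite_net Y_compact eta20.
pose P c := h @^-1` [set y | mdist c y < eta / 2].
have mP c : measurable (P c).
  by apply: (mh [set y | _]); apply: sub_sigma_algebra; exact: open_mball.
have [r [d [E [d0 mE lE EP]]]] := almost_local_seq s mP e0.
exists r, d, E; split => // z z' zz' Ez Ez'.
have [c cs cz] := sP (h z); have cz' := EP z z' zz' Ez Ez' c cs cz.
apply: le_lt_trans (metric_triangle (h z) c (h z')) _.
by rewrite (splitr eta) ltrD// metric_sym.
Qed.

Variables (i j : 'I_n.+1).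
Hypothesis pij : p i = p j.

Lemma foldr_scons_nth (u w : node n.+1) (x : nat -> 'I_n.+1) k :
  (k < size u)%N -> foldr scons x (u ++ w) k = nth ord0 u k.
Proof. by elim: u k => [//|a u IH] [|k] //= /IH. Qed.

(** Once matched at [w], the walks copy [u], so both words start with [u], and the difference of the
    group coordinates stays equal to the gap at [w]. *)
Lemma close_coupled r delta (z z' : words n * borel G) (u w : node n.+1) :
  let near := [pred d | dist d 0 < delta] in
  let d0 := (z.2 : G) - (z'.2 : G) in
  near (gap g i j near d0 w) -> (r <= size u)%N ->
  close_points dist r delta (branch_path (skew_branch g) (u ++ w) z)
    (branch_path (skew_branch g) (twist (coupling g i j near d0) (u ++ w)) z').
Proof.
move=> near d0 nw ru; rewrite !skew_pathE; split => [k kr|].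
  by rewrite /= twist_coupling_cat// !foldr_scons_nth//; exact: leq_trans ru.
rewrite (invariant_distB dist_inv) /=.
suff -> : (z.2 : G) - displacement g (u ++ w) - ((z'.2 : G) -
    displacement g (twist (coupling g i j near d0) (u ++ w))) =
    gap g i j near d0 w by [].
rewrite -(gap_near g i j u nw) -gap_cat gapE opprB /d0.
by rewrite !addrA [RHS](AC (3*1) (1*3*4*2)).
Qed.

Variables (Y : metricType R) (h : words n * borel G -> Y) (b : R).
Hypothesis h_bounded : forall y y', mdist (h y) (h y') <= b.

Let b_ge0 : 0 <= b.
Proof. by apply: le_trans (h_bounded point point); exact: mdist_ge0. Qed.

Let path := branch_path (skew_branch g).

(** A node costs less than [eta] unless its path or the matched path ends in [E], or the matching is
    not achieved [r] levels before; each such failure is charged [b]. *)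
Lemma level_cost r delta E eta k (z z' : words n * borel G) :
  let near := [pred d | dist d 0 < delta] in
  let d0 := (z.2 : G) - (z'.2 : G) in
  let A := twist (coupling g i j near d0) in
  0 <= eta -> (r <= k)%N ->
  (forall y y', close_points dist r delta y y' -> ~ E y -> ~ E y' ->
    mdist (h y) (h y') < eta) ->
  level_sum p k (fun v => mdist (h (path v z)) (h (path (A v) z'))) <=
  eta + b * (level_sum p k (fun v => \1_E (path v z)) +
             level_sum p k (fun v => \1_E (path v z'))) +
  b * miss p g i j near (k - r) d0.
Proof.
move=> near d0 A eta0 rk hE.
have s_p := coupling_weight g near pij d0.
(* The visits of [z'] are summed over matched nodes, so that all terms can be compared node by
   node. *)
rewrite -(level_sum_twist s_p k (fun v => \1_E (path v z'))) -/A.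
(* Summing over the [r] leftmost symbols gives 1, which lifts the sum from level [k - r] to level
   [k]. *)
have -> : miss p g i j near (k - r) d0 =
    level_sum p k (fun v => (~~ near (gap g i j near d0 (drop r v)))%:R).
  rewrite -{2}(subnKC rk) level_sum_cat; apply: eq_level_sum => w.
  rewrite -[LHS](level_sum_cst p_sum1 r); apply: eq_bigr => u _.
  by rewrite drop_size_cat ?size_tuple.
rewrite -{1}(level_sum_cst p_sum1 k eta) -level_sumD -!level_sumZ -!level_sumD.
apply: le_level_sum => // v vk.
have I0 y : 0 <= b * (\1_E y : R) by rewrite mulr_ge0// indicE.
have [nw|_] := boolP (near (gap g i j near d0 (drop r v))); last first.
  by rewrite mulr1; apply: le_trans (h_bounded _ _) _; rewrite lerDr mulrDr !addr_ge0.
rewrite mulr0 addr0 mulrDr.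
have cl : close_points dist r delta (path v z) (path (A v) z').
  have := close_coupled (u := take r v) nw; rewrite cat_take_drop; apply.
  by rewrite size_take vk; case: ifP.
have [Ez|Ez] := pselect (E (path v z)).
  rewrite [X in b * X]indicE mem_set// mulr1.
  by apply: le_trans (h_bounded _ _) _; rewrite addrCA lerDl addr_ge0.
have [Ez'|Ez'] := pselect (E (path (A v) z')).
  rewrite [X in _ + b * X]indicE mem_set// mulr1.
  by apply: le_trans (h_bounded _ _) _; rewrite addrA lerDr addr_ge0.
apply: le_trans (ltW (hE _ _ cl Ez Ez')) _.
by rewrite lerDl addr_ge0.
Qed.

Lemma tbar_cost (K : words n * borel G -> 'I_n.+1)
    (s s' : node n.+1 -> {perm 'I_n.+1}) (r l m : nat) (delta eta c : R)
    (E : set (words n * borel G)) (z z' : words n * borel G) :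
  let near := [pred d | dist d 0 < delta] in
  (forall v a, p (s v a) = p a) ->
  (forall v, branches (skew_shift g) K (twist s v) z = path v z) ->
  (forall v a, p (s' v a) = p a) ->
  (forall v, branches (skew_shift g) K (twist s' v) z' = path v z') ->
  0 <= eta -> 0 <= c ->
  (forall y y', close_points dist r delta y y' -> ~ E y -> ~ E y' ->
    mdist (h y) (h y') < eta) ->
  (forall k d, (l <= k)%N -> miss p g i j near k d <= c) ->
  tbar p m (tree_name (skew_shift g) K h z) (tree_name (skew_shift g) K h z') <=
  m%:R^-1 * (b * (r + l)%:R + m%:R * (eta + b * c) +
    b * (visits p (skew_branch g) m E z + visits p (skew_branch g) m E z')).
Proof.
move=> near s_p sz s'_p sz' eta0 c0 hE missc.
pose t := coupling g i j near ((z.2 : G) - (z'.2 : G)).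
have t_p : forall v a, p (t v a) = p a by exact: coupling_weight.
(* By [twist_comp], [twist s''] is the coupling followed by the relabelling of the tree of [z']. *)
pose s'' w := (t w * s' (twist t w))%g.
have s''_p v a : p (s'' v a) = p a by rewrite permM s'_p t_p.
apply: le_trans (tbar_le_twist m _ _ p_ge0 s_p s''_p) _.
rewrite ler_wpM2l ?invr_ge0//.
pose V k y := level_sum p k (fun v => (\1_E (path v y) : R)).
have V0 k y : 0 <= V k y by apply: level_sum_ge0 => // v; rewrite indicE.
(* Levels below [r + l] are charged [b] outright: [l] steps for the matching to become likely, then
   [r] for the common prefix. *)
rewrite -/path; apply: (@le_trans _ _ (\sum_(1 <= k < m.+1)
    (b * (k < r + l)%N%:R + (eta + b * c) + b * (V k z + V k z')))).
  apply: ler_sum => k _; rewrite /tree_name.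
  rewrite (_ : level_sum _ _ _ = level_sum p k
      (fun v => mdist (h (path v z)) (h (path (twist t v) z')))); last first.
    by apply: eq_level_sum => v; rewrite sz -twist_comp sz'.
  case: ltnP => [kl|lk].
    rewrite mulr1 -addrA; apply: (@le_trans _ _ b); last first.
      by rewrite lerDl !addr_ge0// mulr_ge0// addr_ge0.
    rewrite -[leRHS](level_sum_cst p_sum1 k); exact: le_level_sum.
  rewrite mulr0 add0r.
  have rk : (r <= k)%N by lia.
  apply: le_trans (level_cost _ _ eta0 rk hE) _.
  rewrite -/(V k z) -/(V k z') [leRHS]addrAC lerD2l ler_wpM2l//.
  by apply: missc; lia.
rewrite 2!big_split/= -!big_distrr/= sumr_const_nat subn1/= -natr_sum.
rewrite -[_ *+ m]mulr_natl lerD ?lerD//; last by rewrite /visits big_split.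
by rewrite ler_wpM2l// ler_nat; exact: sum_lt_le.
Qed.

Lemma skew_tvwB_fun K : tree_partition p (mu \x nu)%E (skew_shift g) K ->
  compact [set: G] -> dense [set (g j - g i) *+ k | k in [set: nat]] ->
  borel_measurable h -> compact [set: Y] -> 0 < b ->
  tvwB_fun p (mu \x nu)%E (skew_shift g) K h.
Proof.
move=> treeK G_compact orbit_dense mh Y_compact b_gt0 eps eps0.
(* After division by [m], the initial levels cost at most [eta], close pairs [eta], unmatched nodes
   [b * beta = eta], and the visits to [E] from both points [2 * eta]: in all [5 * eta], below
   [eps]. *)
pose eta := eps / 8; have eta0 : 0 < eta by rewrite divr_gt0.
pose beta := eta / b; have beta0 : 0 < beta by rewrite divr_gt0.
have b_beta : b * beta = eta by rewrite /beta mulrC divfK// gt_eqF.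
have be0 : 0 < beta * eps by rewrite mulr_gt0.
(* The bound [beta * eps] on the measure of [E] is what [visits_rare] needs to give [W] measure at
   most [eps]. *)
have [r [delta [E [delta0 mE lE hE]]]] := almost_local_fun Y_compact mh eta0 be0.
have [M reach] := dense_orbit_reach dist_inv G_compact delta0 orbit_dense.
have [l missl] :=
  miss_small p_gt0 p_sum1 (near := [pred d | dist d 0 < delta]) reach beta0.
have [N _ NP] := nbhs_infty_ger (b * (r + l)%:R / eta).
(* The successor ensures [0 < m], since the tree distance divides by [m]. *)
exists N.+1 => m Nm; have m0 : (0 < m)%N by exact: leq_trans Nm.
have [Z [mZ lZ ZP]] := tree_partition_twist bs (measurable_skew_set1 dist_inv) treeK.
pose W := [set z | beta * m%:R <= visits p (skew_branch g) m E z].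
have mW : measurable W.
  have := measurable_visits bs m mE measurableT (measurable_itv `[beta * m%:R, +oo[).
  rewrite setTI; congr measurable; apply/seteqP.
  by split => z; rewrite /W /= in_itv/= andbT.
have lW : ((mu \x nu) W <= eps%:E)%E by exact: (visits_rare bs).
(* Off the null set [Z] the partition [K] is a relabelling of the first symbol along the whole tree;
   off [W] the visits to [E] are rare. *)
exists (~` (Z `|` W)); split.
- by apply/measurableC/measurableU.
- have mZW := measurableU _ _ mZ mW.
  rewrite EFinB leeBlDr// -[leLHS](product_setT nu mu) -(setvU (Z `|` W)).
  apply: le_trans (measureU2 _ (measurableC mZW) mZW) _; apply: leeD2l.
  apply: le_trans (measureU2 _ mZ mW) _.
  by rewrite [X in (X + _)%E]lZ add0e.
move=> x y /not_orP[Zx Wx] /not_orP[Zy Wy].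
have /contrapT[s s_p sx] := contra_not (@ZP x) Zx.
have /contrapT[s' s'_p s'y] := contra_not (@ZP y) Zy.
apply: le_lt_trans (tbar_cost m s_p sx s'_p s'y (ltW eta0) (ltW beta0) hE missl) _.
have mR : 0 < m%:R :> R by rewrite ltr0n.
rewrite mulrC ltr_pdivrMr// b_beta.
have /ltW Vx : visits p (skew_branch g) m E x < beta * m%:R by rewrite ltNge; exact/negP.
have /ltW Vy : visits p (skew_branch g) m E y < beta * m%:R by rewrite ltNge; exact/negP.
have bV : b * (visits p (skew_branch g) m E x + visits p (skew_branch g) m E y) <=
    2 * eta * m%:R.
  have -> : 2 * eta * m%:R = b * (beta * m%:R + beta * m%:R) by rewrite -b_beta; ring.
  by rewrite ler_wpM2l// lerD.
have bN : b * (r + l)%:R <= eta * m%:R.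
  by have := NP _ (ltnW Nm); rewrite /= ler_pdivrMr// [m%:R * _]mulrC.
have epsE : eps = 8 * eta by rewrite /eta mulrC divfK.
have := mulr_gt0 eta0 mR; rewrite epsE; lra.
Qed.

End very_weak_bernoulli.

Theorem proposition4p2p1 (R : realType) (n : nat) (p : 'I_n.+1 -> R)
    (p_gt0 : forall j, 0 < p j) (p_sum1 : \sum_j p j = 1)
    (G : topologicalZmodType) (G_compact : compact [set: G])
    (dist : G -> G -> R) (dist_inv : invariant_metric dist)
    (nu : probability (borel G) R) (nu_haar : is_haar nu)
    (g : 'I_n.+1 -> G)
    (mu : probability (words n) R) (mu_bernoulli : is_bernoulli p mu)
    (i j : 'I_n.+1) (ij : i != j) (pij : p i = p j)
    (orbit_dense : dense [set (g j - g i) *+ k | k in [set: nat]]) :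
  let lambda := (mu \x nu)%E in
  [/\ measure_preserving lambda (skew_shift g),
      n_to_one p lambda (skew_shift g) &
      tvwB p lambda (skew_shift g)].
Proof.
move=> lambda; have bs := skew_branch_system g p_gt0 p_sum1 dist_inv nu_haar mu_bernoulli.
split; first exact: branch_system_preserving bs.
  exact: branch_n_to_one bs.
split; first by exists first_symbol; exact: branch_tree_partition bs.
move=> K treeK Y Y_compact h mh; have [b b0 hb] := compact_mdist_bounded Y_compact.
apply: (skew_tvwB_fun p_gt0 p_sum1 dist_inv nu_haar mu_bernoulli pij (b := b)) => //.
Qed.
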